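(* Let $G$ be a connected, locally finite chordal graph and let $T$ be a spanning tree of the clique graph of $G$. Then $T$ is a clique tree of $G$ if and only if $T$ has the running intersection property: there is an enumeration $K_1,K_2,\dots$ of the set of cliques of $G$ and, for each $n\ge 2$, an index $1\le i(n)<n$ with $K_n\cap\bigcup_{j=1}^{n-1}K_j\subseteq K_{i(n)}$, such that the edges of $T$ are exactly the pairs $\{K_n,K_{i(n)}\}$, $n\ge 2$.
   Context: A chordal graph is a loopless graph without multiple edges with no induced cycle of length greater than $3$; chordal graphs are assumed connected; locally finite means all degrees finite. A clique is a maximal complete vertex set. The clique graph has the cliques as vertices and an edge between distinct cliques with non-empty intersection. A clique tree is a spanning tree $T$ of the clique graph such that for every vertex $v$ of $G$ the subgraph of $T$ induced by the cliques containing $v$ is a tree. *)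

(* Defs.v *)
From mathcomp Require Import all_boot.
From mathcomp Require Import boolp classical_sets functions cardinality.

Set Implicit Arguments.
Unset Strict Implicit.
Unset Printing Implicit Defensive.

Local Open Scope classical_set_scope.

(* Simple graphs, possibly infinite, whose vertices form an arbitrary subset of
   the carrier; induced subgraphs and the clique graph are then graphs too. *)
Record sgraph (U : eqType) := SGraph {
  vtx : set U;
  adj : rel U;
  adj_sym : symmetric adj;
  adj_irr : irreflexive adj;
  adj_vtx : forall x y, adj x y -> vtx x
}.

Section Graphs.
Variable U : eqType.
Implicit Types (G H T : sgraph U) (A : set U) (c : seq U).

Definition connected G :=
  vtx G !=set0 /\
  forall x y, vtx G x -> vtx G y -> exists p, path (adj G) x p /\ last x p = y.

Definition locally_finite G :=
  forall x, vtx G x -> finite_set [set y | adj G x y].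

(* The size bound is needed: [cycle] also accepts [::] and x - y - x. *)
Definition graph_cycle G c :=
  [/\ 3 <= size c, uniq c & cycle (adj G) c].

Definition induced_cycle G c :=
  graph_cycle G c /\
  forall x y, x \in c -> y \in c -> adj G x y -> y = next c x \/ x = next c y.

Definition chordal G := forall c, induced_cycle G c -> size c <= 3.

Definition is_tree G := connected G /\ forall c, ~ graph_cycle G c.

Definition induced_adj G A : rel U :=
  fun x y => [&& x \in A, y \in A & adj G x y].

Lemma induced_adj_sym G A : symmetric (induced_adj G A).
Proof. by move=> x y; rewrite /induced_adj adj_sym andbCA. Qed.

Lemma induced_adj_irr G A : irreflexive (induced_adj G A).
Proof. by move=> x; rewrite /induced_adj adj_irr !andbF. Qed.

Lemma induced_adj_vtx G A x y : induced_adj G A x y -> (vtx G `&` A) x.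
Proof. by case/and3P=> /set_mem Ax _ /adj_vtx. Qed.

Definition induced G A : sgraph U :=
  SGraph (@induced_adj_sym G A) (@induced_adj_irr G A) (@induced_adj_vtx G A).

Definition spanning_tree H T :=
  [/\ vtx T = vtx H, subrel (adj T) (adj H) & is_tree T].

End Graphs.

Section Cliques.
Variable V : eqType.
Implicit Types (G : sgraph V) (T : sgraph (set V)) (A B K L : set V).

Definition complete_set G A :=
  A `<=` vtx G /\ forall x y, A x -> A y -> x != y -> adj G x y.

Definition clique G A :=
  complete_set G A /\ forall B, complete_set G B -> A `<=` B -> B = A.

Definition clique_adj G : rel (set V) :=
  fun K L => `[< [/\ clique G K, clique G L, K <> L & K `&` L !=set0] >].

Lemma clique_adj_sym G : symmetric (clique_adj G).
Proof.
move=> K L; apply/asboolP/asboolP=> -[cK cL nKL KL];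
  by split=> //; [exact: nesym | rewrite setIC].
Qed.

Lemma clique_adj_irr G : irreflexive (clique_adj G).
Proof. by move=> K; apply/asboolPn => -[]. Qed.

Lemma clique_adj_vtx G K L : clique_adj G K L -> [set K | clique G K] K.
Proof. by move/asboolP=> -[]. Qed.

Definition clique_graph G : sgraph (set V) :=
  SGraph (@clique_adj_sym G) (@clique_adj_irr G) (@clique_adj_vtx G).

Definition clique_tree G T :=
  spanning_tree (clique_graph G) T /\
  forall v, vtx G v -> is_tree (induced T [set K | K v]).

(* Indices start at 0.  There may be finitely or infinitely many cliques, so
   the index set D of the enumeration is an arbitrary initial segment of nat,
   i.e. `I_N or all of nat; values of K and i outside D are irrelevant. *)
Definition running_intersection G T :=
  exists (D : set nat) (K : nat -> set V) (i : nat -> nat),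
    [/\ forall m n, D n -> m <= n -> D m,
        set_bij D [set A | clique G A] K,
        forall n, D n -> 0 < n ->
          i n < n /\ K n `&` (\bigcup_(j < n) K j) `<=` K (i n) &
        forall A B, adj T A B <->
          exists n, [/\ D n, 0 < n &
            (A = K n /\ B = K (i n)) \/ (A = K (i n) /\ B = K n)]].

End Cliques.

(* Main.v *)
(* Local finiteness makes the clique graph locally finite, so a spanning tree T
   is countable. Root T and enumerate it so that every clique comes after its
   parent i(n). If T is a clique tree and v lies in K_n and in an earlier K_j,
   the walk from K_n to K_j inside the subtree of v must use the edge from K_n to
   its parent: removing this edge separates K_n from all earlier cliques, since
   these reach the root through parents that precede K_n. Conversely, running
   intersection leads from any clique containing v, through cliques containing v,
   down to the first clique of the enumeration that contains v. *)
Require Import Defs.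
From mathcomp Require Import all_boot.
From mathcomp Require Import boolp classical_sets functions cardinality.

Set Implicit Arguments.
Unset Strict Implicit.
Unset Printing Implicit Defensive.

Local Open Scope classical_set_scope.

(** * Walks along a relation, and ranks in the naturals *)

Section Walks.
Variable U : eqType.
Implicit Types (e : rel U) (x y z : U).

Definition walk e x y := exists p, path e x p /\ last x p = y.

Lemma walk_refl e x : walk e x x.
Proof. by exists [::]. Qed.

Lemma walk_step e x y : e x y -> walk e x y.
Proof. by move=> exy; exists [:: y]; rewrite /= exy. Qed.

Lemma walk_trans e y x z : walk e x y -> walk e y z -> walk e x z.
Proof.
move=> [p [ep <-]] [q [eq <-]].
by exists (p ++ q); rewrite cat_path ep eq last_cat.
Qed.

Lemma walk_sym e x y : symmetric e -> walk e x y -> walk e y x.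
Proof.
move=> se [p [ep <-]]; exists (rev (belast x p)); split.
  by rewrite rev_path (@eq_path _ _ e) // => u v; rewrite /= se.
by case: p ep => //= z p _; rewrite rev_cons last_rcons.
Qed.

Lemma sub_walk e e' x y : subrel e e' -> walk e x y -> walk e' x y.
Proof. by move=> ee' [p [ep lp]]; exists p; split=> //; apply: sub_path ep. Qed.

End Walks.

(** The rank of [x] is the number of values of [f] on [A] below [f x]; closing the gaps in the image
    keeps the order and leaves an initial segment. *)
Lemma nat_enumeration (U : Type) (A : set U) (f : U -> nat) :
  {in A &, injective f} ->
  exists rk : U -> nat,
    [/\ forall m n, (rk @` A) n -> m <= n -> (rk @` A) m,
        {in A &, injective rk} &
        forall x y, A x -> A y -> (rk x < rk y) = (f x < f y)].
Proof.
move=> injf; pose P k := `[< exists2 y, A y & f y = k >].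
pose r k := count P (iota 0 k).
have rS k : r k.+1 = r k + P k by rewrite /r -addn1 iotaD count_cat /= addn0.
have r_le : {homo r : m n / m <= n}.
  by apply: (homo_leq leqnn leq_trans) => k; rewrite rS leq_addr.
have Pf x : A x -> P (f x) by move=> Ax; apply/asboolP; exists x.
have r_lt x y : A x -> A y -> (r (f x) < r (f y)) = (f x < f y).
  move=> Ax Ay; case: (ltnP (f x) (f y)) => [lt_xy|/r_le]; last first.
    by rewrite leqNgt => /negbTE.
  by apply: leq_trans (r_le _ _ lt_xy); rewrite rS Pf // addn1.
exists (r \o f); split=> //.
(* [r] grows by at most one at a time, and only at values of [f] on [A], so no rank is skipped. *)
- have hit k m : m < r k -> exists2 y, A y & r (f y) = m.
    elim: k => // k IHk; rewrite rS => lt_m.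
    have [/IHk //|le_m] := ltnP m (r k).
    case Pk: (P k) lt_m => lt_m; last by rewrite addn0 ltnNge le_m in lt_m.
    have /asboolP[y Ay fy] := Pk; exists y => //; apply/eqP.
    by move: lt_m; rewrite fy eqn_leq le_m addn1 ltnS.
  move=> m _ [x Ax <-]; rewrite leq_eqVlt => /predU1P[->|/hit//].
  by exists x.
- move=> x y Ax Ay /= rxy; apply: injf => //; rewrite !inE in Ax Ay.
  have := r_lt _ _ Ax Ay; have := r_lt _ _ Ay Ax.
  by rewrite rxy ltnn; case: ltngtP.
Qed.

(** * Bridges, countability and distance to a root *)

Section Trees.
Variables (U : eqType) (T : sgraph U).
Implicit Types (x y z r : U) (A : set U).

Definition remove_edge (a b : U) : rel U :=
  fun x y => adj T x y && ~~ ((x == a) && (y == b) || (x == b) && (y == a)).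

Lemma remove_edge_sym a b : symmetric (remove_edge a b).
Proof.
by move=> x y; rewrite /remove_edge adj_sym orbC [(y == a) && _]andbC
  [(y == b) && _]andbC.
Qed.

(** A walk avoiding the edge shortens to a simple path; this has at least two edges, so the edge
    closes it to a cycle. *)
Lemma acyclic_bridge a b : (forall c, ~ graph_cycle T c) -> adj T a b ->
  ~ walk (remove_edge a b) a b.
Proof.
move=> acyc Tab [p [ep lp]]; case/shortenP: ep lp => q eq uq _.
case: q eq uq => [|z [|w q]] eq uq /= lq.
- by rewrite lq adj_irr in Tab.
- by move: eq; rewrite /= lq /remove_edge !eqxx andbF.
- apply: (acyc [:: a, z, w & q]); split=> //.
  rewrite /cycle rcons_path [last _ _]lq adj_sym Tab andbT.
  by apply: sub_path eq => u v /andP[].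
Qed.

(** [B n] holds the ends of walks of length [n] from [r]: finite by local finiteness, and together
    they cover a connected graph. *)
Lemma locally_finite_countable :
  connected T -> locally_finite T -> countable (vtx T).
Proof.
move=> [[r Tr] conT] lfT; pose B := fix B n :=
  if n is n.+1 then \bigcup_(y in B n) [set z | adj T y z] else [set r].
have finB n : finite_set (B n).
  elim: n => [|n IHn] /=; first exact: finite_set1.
  apply: bigcup_finite => // y _.
  have [/lfT //|nTy] := pselect (vtx T y).
  by apply: sub_finite_set (finite_set0 _) => z /adj_vtx.
apply: (@sub_countable _ _ _ (\bigcup_n B n)); last first.
  by apply: bigcup_countable => // n _; apply: finite_set_countable.
apply: subset_card_le => x Tx.
have B_last p : path (adj T) r p -> B (size p) (last r p).
  elim/last_ind: p => // p z IHp; rewrite rcons_path size_rcons last_rcons.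
  by move=> /andP[/IHp Bp Tz]; exists (last r p).
by have [p [/B_last Bp <-]] := conT _ _ Tr Tx; exists (size p).
Qed.

(** [d] is the distance to [r], and [par x] the second vertex of a shortest path from [x]. *)
Lemma bfs_parent r : connected T -> vtx T r ->
  exists (d : U -> nat) (par : U -> U), forall x, vtx T x -> x <> r ->
    adj T x (par x) /\ d x = (d (par x)).+1.
Proof.
move=> [_ conT] Tr.
pose reach x n := exists p, [/\ path (adj T) x p, last x p = r & size p = n].
have exd x : exists n, vtx T x -> reach x n /\ forall m, reach x m -> n <= m.
  have [Tx|?] := pselect (vtx T x); last by exists 0.
  have [|n /asboolP rn min_n] := @ex_minnP (fun n => `[< reach x n >]).
    have [p [ep lp]] := conT _ _ Tx Tr.
    by exists (size p); apply/asboolP; exists p.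
  by exists n => _; split=> // m /asboolP/min_n.
have [d dP] := choice exd.
have expar x : exists y, vtx T x -> x <> r -> adj T x y /\ d x = (d y).+1.
  have [Tx|?] := pselect (vtx T x); last by exists x.
  have [[[|y p] [ep lp sp]] min_x] := dP x Tx; first by exists x.
  move: ep => /= /andP[Txy ep]; exists y => _ _; split=> //.
  have Ty : vtx T y by rewrite adj_sym in Txy; apply: adj_vtx Txy.
  have [[q [eq lq sq]] min_y] := dP y Ty.
  apply/eqP; rewrite eqn_leq min_x /=; last first.
    by exists (y :: q); rewrite /= Txy eq sq.
  by rewrite -sp ltnS; apply: min_y; exists p.
by have [par parP] := choice expar; exists d, par.
Qed.

Lemma tree_code r : connected T -> countable (vtx T) -> vtx T r ->
  exists (par : U -> U) (f : U -> nat), {in vtx T &, injective f} /\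
    forall x, vtx T x -> x <> r -> adj T x (par x) /\ f (par x) < f x.
Proof.
move=> conT /countable_injP[idx inj_idx] Tr.
have [d [par parP]] := bfs_parent conT Tr.
(* The binary code of the indices met on the way to the root: it is injective
   since its first letter determines x, and prepending a letter increases it. *)
pose f x := CodeSeq.code [seq idx y | y <- traject par x (d x).+1].
exists par, f; split=> [x y Tx Ty /(can_inj CodeSeq.codeK)[]|x Tx xr].
  by move/inj_idx=> -> //.
have [Txp dx] := parP x Tx xr; split=> //.
(* This is the recursion of [CodeSeq.code]: since [d] drops by one, the tail of the word of [x] is
   the word of [par x]. *)
have -> : f x = 2 ^ idx x * (f (par x)).*2.+1 by rewrite {1}/f dx.
apply: (@leq_trans (f (par x)).*2.+1); first by rewrite ltnS -addnn leq_addr.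
by rewrite leq_pmull ?expn_gt0.
Qed.

(** * Trees whose parents have smaller codes *)

Section RootedTree.
Variables (r : U) (par : U -> U) (f : U -> nat).
Hypothesis acycT : forall c, ~ graph_cycle T c.
Hypothesis parP :
  forall x, vtx T x -> x <> r -> adj T x (par x) /\ f (par x) < f x.

(** The chain of parents only visits codes up to [f x], so [e] may lack edges elsewhere; this allows
    an edge to be removed. *)
Lemma walk_to_root (e : rel U) x : vtx T x ->
  (forall z, vtx T z -> z <> r -> f z <= f x -> e z (par z)) -> walk e x r.
Proof.
have [n] := ubnP (f x); elim: n x => // n IHn x; rewrite ltnS => fx Tx eP.
have [->|/eqP xr] := eqVneq x r; first exact: walk_refl.
have [Txp fp] := parP Tx xr.
apply: (@walk_trans _ _ (par x)); first by apply: walk_step; apply: eP.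
apply: IHn; first exact: leq_trans fx.
  by rewrite adj_sym in Txp; apply: adj_vtx Txp.
by move=> z Tz zr fz; apply: eP => //; apply: leq_trans fz (ltnW fp).
Qed.

(** Otherwise both ends would still reach [r] through parents once the edge is removed, although it
    is a bridge. *)
Lemma edge_parent x y : adj T x y -> x <> r /\ y = par x \/ y <> r /\ x = par y.
Proof.
move=> Txy; apply: contrapT => /not_orP[nx ny].
have Tx := adj_vtx Txy; have Ty : vtx T y.
  by rewrite adj_sym in Txy; apply: adj_vtx Txy.
have eP z : vtx T z -> z <> r -> remove_edge x y z (par z).
  move=> Tz zr; have [Tzp _] := parP Tz zr; rewrite /remove_edge Tzp /=.
  apply/negP => /orP[]/andP[/eqP zE /eqP pE]; rewrite zE in zr pE.
    by apply: nx.
  by apply: ny.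
apply: (acyclic_bridge acycT Txy); apply: (@walk_trans _ _ r).
  by apply: walk_to_root => // z *; apply: eP.
apply: walk_sym; first exact: remove_edge_sym.
by apply: walk_to_root => // z *; apply: eP.
Qed.

Lemma parent_in_subtree A x y : vtx T x -> x <> r -> vtx T y -> f y < f x ->
  A x -> A y -> connected (induced T A) -> A (par x).
Proof.
move=> Tx xr Ty fyx Ax Ay [_ conA]; apply: contrapT => nAp.
have [Txp fpx] := parP Tx xr.
have Tp : vtx T (par x) by rewrite adj_sym in Txp; apply: adj_vtx Txp.
pose e := remove_edge x (par x).
(* Codes fall along the chain of parents, so from below [f x] it never meets [x], nor the removed
   edge. *)
have to_root z : vtx T z -> f z < f x -> walk e z r.
  move=> Tz fzx; apply: walk_to_root => // w Tw wr fw.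
  have fwx := leq_ltn_trans fw fzx; have [Twp fpw] := parP Tw wr.
  rewrite /e /remove_edge Twp /=; apply/negP => /orP[]/andP[/eqP wE /eqP pE].
    by rewrite wE ltnn in fwx.
  by have := ltn_trans fpw fwx; rewrite pE ltnn.
apply: (acyclic_bridge acycT Txp); apply: (@walk_trans _ _ y).
  have [||p [ep lp]] := conA x y; [by split..|].
  exists p; split=> //; apply: sub_path ep => u v.
  rewrite /= /induced_adj => /and3P[/set_mem Au /set_mem Av Tuv].
  rewrite /e /remove_edge Tuv /=; apply/negP => /orP[]/andP[/eqP uE /eqP vE].
    by rewrite vE in Av.
  by rewrite uE in Au.
apply: (@walk_trans _ _ r); first exact: to_root.
by apply: walk_sym; [exact: remove_edge_sym|exact: to_root].
Qed.

End RootedTree.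
End Trees.

(** * Existence of cliques and local finiteness of the clique graph *)

Section Cliques.
Variables (V : eqType) (G : sgraph V).

(** Zorn is applied to the sets that become complete once [v] is added, a property that the empty
    chain also satisfies. *)
Lemma vertex_in_clique v : vtx G v -> exists2 K, clique G K & K v.
Proof.
move=> Gv; have [F FP totF|A [cA maxA]] :=
    @Zorn_bigcup V (fun A => complete_set G (v |` A)).
  (* The case [x = y = v] is excluded because an empty chain has no member to offer. *)
  have common x y : (v |` \bigcup_(X in F) X) x ->
      (v |` \bigcup_(X in F) X) y -> x != y ->
      exists2 X, F X & (v |` X) x /\ (v |` X) y.
    move=> [->|[X FX Xx]] [->|[Y FY Yy]]; rewrite ?eqxx // => _.
    - by exists Y => //; split; [left|right].
    - by exists X => //; split; [right|left].
    - by have [XY|YX] := totF _ _ FX FY; [exists Y|exists X] => //;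
        split; right; auto.
  split=> [x [->//|[X FX Xx]]|x y Fx Fy nxy].
    by have [sXG _] := FP _ FX; apply: sXG; right.
  have [X FX [Xx Xy]] := common _ _ Fx Fy nxy.
  by have [_ cX] := FP _ FX; apply: cX.
exists (v |` A); last by left.
split=> // B cB sAB; apply: contrapT => neBA; apply: (maxA B).
  split=> [x Ax|sBA]; first by apply: sAB; right.
  by apply: neBA; apply/seteqP; split=> // x Bx; right; apply: sBA.
by have -> : v |` B = B by apply/seteqP; split=> [x [->|]|x] //;
  [apply: sAB; left|right].
Qed.

Lemma finite_subsets (A : set V) :
  finite_set A -> finite_set [set B : set V | B `<=` A].
Proof.
move=> /finite_seqP[s ->].
pose g (m : (size s).-tuple bool) : set V := [set` mask m s].
apply: sub_finite_set (finite_image g (@finite_finset _ setT)) => B sB.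
exists (map_tuple (fun x => x \in B) (in_tuple s)) => //.
rewrite /g /= -filter_mask; apply/seteqP; split=> x /=; rewrite mem_filter.
  by case/andP=> /set_mem.
by move=> Bx; rewrite (sB x Bx) andbT; apply/mem_set.
Qed.

Hypothesis lfG : locally_finite G.

Lemma complete_set_ball v K : complete_set G K -> K v ->
  K `<=` v |` [set y | adj G v y].
Proof.
move=> [_ cK] Kv w Kw; have [->|nvw] := eqVneq w v; [by left|right].
by apply: cK => //; rewrite eq_sym.
Qed.

Lemma finite_ball v : vtx G v -> finite_set (v |` [set y | adj G v y]).
Proof.
by move=> Gv; rewrite finite_setU; split; [exact: finite_set1|exact: lfG].
Qed.

(** A clique meeting [K] at [v] is a subset of the finite closed neighbourhood of [v], and [K]
    itself is finite. *)
Lemma clique_graph_locally_finite : locally_finite (clique_graph G).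
Proof.
move=> K cK; have sKG : K `<=` vtx G by case: cK => [] [].
have finK : finite_set K.
  have [->|/set0P[v Kv]] := eqVneq K set0; first exact: finite_set0.
  apply: sub_finite_set (finite_ball (sKG v Kv)).
  by apply: complete_set_ball => //; case: cK.
apply: (@sub_finite_set _ _
  (\bigcup_(v in K) [set L | L `<=` v |` [set y | adj G v y]])).
  move=> L /asboolP[_ [cL _] _ [v [Kv Lv]]]; exists v => //.
  exact: complete_set_ball.
by apply: bigcup_finite => // v /sKG Gv; apply/finite_subsets/finite_ball.
Qed.


(** * From clique trees to running intersection *)

Lemma clique_tree_running_intersection (T : sgraph (set V)) :
  clique_tree G T -> running_intersection G T.
Proof.
move=> [[vT sT [conT acyT]] subT]; have [[R TR] _] := conT.
have lfT : locally_finite T.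
  move=> K; rewrite vT => /clique_graph_locally_finite.
  by apply: sub_finite_set => L /sT.
have [par [f [inj_f parP]]] :=
  tree_code conT (locally_finite_countable conT lfT) TR.
have [rk [D_down inj_rk rk_lt]] := nat_enumeration inj_f.
(* [K] inverts the rank on [D] and defaults to the root elsewhere. *)
pose D := rk @` vtx T; pose K := 'pinv_(fun=> R) (vtx T) rk.
have DK n : D n -> vtx T (K n) /\ rk (K n) = n.
  move=> Dn; split; last by apply: pinvK; rewrite inE.
  by have [fK _ _] := injpinv_bij (fun=> R) inj_rk; apply: fK.
have Krk x : vtx T x -> K (rk x) = x.
  by move=> Tx; apply: pinvKV; rewrite ?inE.
have Drk x : vtx T x -> D (rk x) by exists x.
have Tpar x : vtx T x -> x <> R -> vtx T (par x).
  by move=> Tx /(parP _ Tx)[]; rewrite adj_sym => /adj_vtx.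
have rk_par x : vtx T x -> x <> R -> rk (par x) < rk x.
  by move=> Tx xR; rewrite rk_lt //; [case: (parP x Tx xR)|apply: Tpar].
have D0 : D 0 by apply: D_down (Drk _ TR) _.
(* Any other clique has a parent of smaller rank. *)
have K0 : K 0 = R.
  apply: contrapT => K0R; have [TK0 rK0] := DK _ D0.
  by have := rk_par _ TK0 K0R; rewrite rK0.
have KR n : D n -> 0 < n -> K n <> R.
  by move=> Dn n_gt0 KnR; have := DK _ Dn; rewrite KnR -K0 (DK _ D0).2
    => -[_ n0]; rewrite -n0 in n_gt0.
have rk_gt0 x : vtx T x -> x <> R -> 0 < rk x.
  by move=> Tx xR; apply: leq_ltn_trans (rk_par _ Tx xR).
exists D, K, (fun n => rk (par (K n))); split=> //.
- by have := injpinv_bij (fun=> R) inj_rk; rewrite {2}vT.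
- move=> n Dn n_gt0; have [TKn rKn] := DK _ Dn.
  have KnR := KR _ Dn n_gt0.
  split=> [|v [Kv [j /= lt_jn Kjv]]]; first by rewrite -{2}rKn; apply: rk_par.
  rewrite Krk; last exact: Tpar.
  have [TKj rKj] := DK _ (D_down _ _ Dn (ltnW lt_jn)).
  have Gv : vtx G v.
    by move: TKn; rewrite vT => -[[sKG _] _]; apply: sKG.
  apply: (parent_in_subtree (A := [set L | L v]) acyT parP TKn KnR TKj) => //.
    by rewrite -rk_lt // rKn rKj.
  by case: (subT v Gv).
- move=> A B; split=> [TAB|[n [Dn n_gt0 AB]]].
    have TA := adj_vtx TAB; have TB : vtx T B.
      by rewrite adj_sym in TAB; apply: adj_vtx TAB.
    have [[xR ->]|[yR ->]] := edge_parent acyT parP TAB.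
      exists (rk A); split; [exact: Drk|exact: rk_gt0|left].
      by rewrite Krk // Krk //; apply: Tpar.
    exists (rk B); split; [exact: Drk|exact: rk_gt0|right].
    by rewrite Krk // Krk //; apply: Tpar.
  have [TKn _] := DK _ Dn; have KnR := KR _ Dn n_gt0.
  have [Tnp _] := parP _ TKn KnR.
  case: AB => -[-> ->]; rewrite Krk //; try exact: Tpar.
  by rewrite adj_sym.
Qed.

End Cliques.

(** * From running intersection to clique trees *)

Lemma running_intersection_clique_tree (V : eqType) (G : sgraph V)
    (T : sgraph (set V)) :
  spanning_tree (clique_graph G) T -> running_intersection G T ->
  clique_tree G T.
Proof.
move=> hT [D [K [i [D_down [fK injK surjK] rip edgeT]]]].
split=> // v Gv; have [vT _ [_ acyT]] := hT.
split=> [|c [sc uc cc]]; last first.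
  apply: (acyT c); split=> //; case: c cc {sc uc} => //= x c.
  by apply: sub_path => y z /and3P[].
have [L cL Lv] := vertex_in_clique Gv.
pose e := adj (induced T [set L | L v]).
have [n Dn KnL] := surjK _ cL.
have [|m /asboolP[Dm Kmv] min_m] :=
    @ex_minnP (fun m => `[< D m /\ K m v >]).
  by exists n; apply/asboolP; rewrite KnL.
have to_m k : D k -> K k v -> walk e (K k) (K m).
  have [b] := ubnP k; elim: b k => // b IHb k; rewrite ltnS => le_kb Dk Kkv.
  have : m <= k by apply: min_m; apply/asboolP.
  rewrite leq_eqVlt => /predU1P[->|lt_mk]; first exact: walk_refl.
  have k_gt0 : 0 < k := leq_ltn_trans (leq0n m) lt_mk.
  have [lt_ik rik] := rip _ Dk k_gt0.
  (* [v] lies in [K k] and in the earlier [K m], hence in the intersection that [K (i k)]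
     contains. *)
  have Kikv : K (i k) v by apply: rik; split=> //; exists m.
  apply: (@walk_trans _ _ (K (i k))).
    apply: walk_step; apply/and3P; split; [exact/mem_set..|].
    by apply/edgeT; exists k; split=> //; left.
  by apply: IHb => //; [exact: leq_trans le_kb|exact: D_down (ltnW lt_ik)].
split; first by exists L; split=> //; rewrite vT.
move=> A B [TA Av] [TB Bv]; rewrite vT in TA TB.
have [a Da KaA] := surjK _ TA; have [b Db KbB] := surjK _ TB.
rewrite -KaA -KbB; apply: (@walk_trans _ _ (K m)).
  by apply: to_m; rewrite ?KaA.
apply: walk_sym; first exact: induced_adj_sym.
by apply: to_m; rewrite ?KbB.
Qed.

Theorem theorem4p2 (V : eqType) (G : sgraph V) (T : sgraph (set V))
    (hconn : connected G) (hlf : locally_finite G) (hchord : chordal G)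
    (hT : spanning_tree (clique_graph G) T) :
  clique_tree G T <-> running_intersection G T.
Proof.
split; first exact: clique_tree_running_intersection.
exact: running_intersection_clique_tree.
Qed.
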